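(* Let $\mathcal{H}$ be an infinite-dimensional, separable, complex Hilbert space. There does not exist a normal operator \[ D=\begin{bmatrix} D_1 & D_2 \\ D_3 & D_4 \end{bmatrix} \] in $\mathcal{B}(\mathcal{H}\oplus \mathcal{H})$ such that $D_2$ is invertible and $D_3$ is compact.
   Context: $\mathcal{B}(\mathcal{H}\oplus\mathcal{H})$ denotes the bounded linear operators on $\mathcal{H}\oplus\mathcal{H}$; the block entries $D_1,D_2,D_3,D_4\in\mathcal{B}(\mathcal{H})$ are taken relative to the direct sum $\mathcal{H}\oplus\mathcal{H}$, i.e. $D(x,y)=(D_1x+D_2y,\,D_3x+D_4y)$. *)

(* Defs.v *)
From HB Require Import structures.
From mathcomp Require Import all_boot all_order all_algebra sesquilinear.
From mathcomp Require Import complex.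
From mathcomp Require Import boolp classical_sets cardinality reals.
From mathcomp Require Import topology normedtype.

Set Implicit Arguments.
Unset Strict Implicit.
Unset Printing Implicit Defensive.

Import Order.TTheory GRing.Theory Num.Theory Num.Def.
Import numFieldNormedType.Exports.

Local Open Scope classical_set_scope.
Local Open Scope ring_scope.
Local Open Scope complex_scope.

(* A complex Hilbert space: a Banach space over R[i] whose norm comes from an
   inner product.  {dot H for conjC} is the library's type of positive definite
   Hermitian forms; they are linear in the first argument and conjugate-linear
   in the second.  Norms take their values in R[i]. *)
HB.mixin Record hasInnerProduct (R : realType) H
    of CompleteNormedModule R[i] H := {
  inner : {dot H for conjC} ;
  inner_norm : forall x : H, inner x x = `|x| ^+ 2
}.

#[short(type="hilbertType")]
HB.structure Definition Hilbert (R : realType) :=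
  { H of hasInnerProduct R H & CompleteNormedModule R[i] H }.

Section HilbertSpace.
Context {R : realType}.

Definition infinite_dimensional (V : lmodType R[i]) : Prop :=
  ~ exists (n : nat) (e : 'I_n -> V),
      forall x : V, exists c : 'I_n -> R[i], x = \sum_(i < n) c i *: e i.

Definition separable (T : topologicalType) : Prop :=
  exists2 A : set T, countable A & dense A.

Definition bounded_operator (V W : normedModType R[i]) (T : V -> W) : Prop :=
  exists M : R, forall x : V, `|T x| <= M%:C * `|x|.

Definition is_adjoint (V : lmodType R[i]) (ip : {dot V for conjC})
    (T S : V -> V) : Prop :=
  forall x y : V, ip (T x) y = ip x (S y).

Definition normal_operator (V : normedModType R[i]) (ip : {dot V for conjC})
    (T : {linear V -> V}) : Prop :=
  exists S : {linear V -> V},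
    [/\ bounded_operator S, is_adjoint ip T S & T \o S =1 S \o T].

Definition invertible_operator (V : normedModType R[i])
    (T : {linear V -> V}) : Prop :=
  exists S : {linear V -> V},
    [/\ bounded_operator S, cancel T S & cancel S T].

Definition compact_operator (V W : normedModType R[i])
    (T : {linear V -> W}) : Prop :=
  precompact (T @` [set x : V | `|x| <= 1]).

End HilbertSpace.

Section DirectSum.
Context {R : realType} {H : hilbertType R}.

(* The inner product of the Hilbert space direct sum.  The library norms
   (H * H) with the maximum of the two component norms, which is equivalent to
   the norm of this inner product; bounded_operator does not distinguish
   equivalent norms. *)
Definition dsum_inner (u v : H * H) : R[i] :=
  inner u.1 v.1 + inner u.2 v.2.

Lemma dsum_inner_linearl (v : H * H) : linear_for *%R (dsum_inner^~ v).
Proof.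
move=> a x y; rewrite /dsum_inner /= !linearPl /=.
by rewrite mulrDr addrACA.
Qed.

Lemma dsum_inner_linearr (u : H * H) :
  linear_for (conjC \; *%R) (dsum_inner u).
Proof.
move=> a x y; rewrite /dsum_inner /= !linearPr /=.
by rewrite mulrDr addrACA.
Qed.

HB.instance Definition _ :=
  bilinear_isBilinear.Build R[i] (H * H)%type (H * H)%type R[i] *%R
    (conjC \; *%R) dsum_inner (dsum_inner_linearl, dsum_inner_linearr).

Lemma dsum_inner_hermitian (u v : H * H) :
  dsum_inner u v = (-1) ^+ false * conjC (dsum_inner v u).
Proof.
rewrite /dsum_inner expr0 mul1r rmorphD /=.
by rewrite (hermC inner u.1) (hermC inner u.2) expr0 !mul1r.
Qed.

HB.instance Definition _ :=
  isHermitianSesquilinear.Build R[i] (H * H)%type false conjC dsum_inner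
    dsum_inner_hermitian.

Lemma dsum_inner_gt0 (u : H * H) : u != 0 -> 0 < dsum_inner u u.
Proof.
rewrite /dsum_inner !inner_norm => u0.
have [u10|u10] := eqVneq u.1 0; last first.
  by apply: ltr_pwDl; rewrite ?exprn_gt0 ?normr_gt0 ?exprn_ge0.
rewrite u10 normr0 expr0n add0r exprn_gt0 // normr_gt0.
by apply: contraNneq u0 => u20; case: u u10 u20 => a b /= -> ->.
Qed.

HB.instance Definition _ :=
  isDotProduct.Build R[i] (H * H)%type dsum_inner dsum_inner_gt0.

Definition block_operator (D1 D2 D3 D4 : H -> H) (u : H * H) : H * H :=
  (D1 u.1 + D2 u.2, D3 u.1 + D4 u.2).

End DirectSum.

(* Main.v *)
Require Import Defs.
From mathcomp Require Import all_boot all_order all_algebra sesquilinear.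
From mathcomp Require Import complex.
From mathcomp Require Import boolp classical_sets cardinality reals.
From mathcomp Require Import topology normedtype.
From mathcomp Require Import finmap ring.
Import Order.TTheory GRing.Theory Num.Theory Num.Def.
Import numFieldNormedType.Exports.

(** The idea is that of the Calkin algebra.  The upper left blocks of
    [D^* D = D D^*] give [D1^* D1 - D1 D1^* = D2 D2^* - D3^* D3].  Modulo the
    compact operators the right-hand side is at least some [c > 0], as [D2] is
    invertible and [D3] is compact.  But in a unital C*-algebra
    other than zero [a^* a >= a a^* + c] is impossible, since taking norms it
    would give [|a| ^ 2 >= |a| ^ 2 + c].

    The quotient is avoided by following a single orbit [x_k = D1^k x].  As long
    as [D3] is small on [x_k], the identity bounds [|D1 x_k| ^ 2] from below by
    [|D1^* x_k| ^ 2 + c |x_k| ^ 2] ([normal_block_norm], [corner_estimate]), and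
    [|D1^* x_k|] is at least [|x_k| ^ 2 / |x_(k-1)|] because
    [<D1^* x_k, x_(k-1)> = |x_k| ^ 2].  So the ratio
    [|x_(k+1)| ^ 2 / |x_k| ^ 2] increases by [c] at each step
    ([orbit_ratio_growth]), and after finitely many steps it exceeds the square
    of any given bound for [D1].  It remains to start with a nonzero [x] such
    that [D3] is small on the first [n + 1] points of the orbit: smallness of
    a compact operator at a point follows from finitely many linear equations
    ([compact_small_orthogonal]), and finitely many linear equations have a
    nonzero common solution in infinite dimension
    ([common_kernel_nontrivial]). *)

Set Implicit Arguments.
Unset Strict Implicit.
Unset Printing Implicit Defensive.

Local Open Scope classical_set_scope.
Local Open Scope ring_scope.
Local Open Scope complex_scope.

(** * Sequences with growing ratios *)

(** Dividing the hypothesis by [a k * a k.+1] shows that the ratio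
    [a k.+1 / a k] increases by at least [c] at each step. *)
Lemma ratio_growth (F : numFieldType) (c : F) (a : nat -> F) (n : nat) :
  0 <= c -> (forall k, (k <= n)%N -> 0 < a k) -> 0 <= a n.+1 ->
  (forall k, (k < n)%N -> a k.+1 ^+ 2 + c * a k * a k.+1 <= a k.+2 * a k) ->
  n%:R * c * a n <= a n.+1.
Proof.
move=> c0 a0 an0 astep; elim: n => [|n IH] in a0 an0 astep *.
  by rewrite !mul0r.
have an : 0 < a n by apply: a0.
have an1 : 0 < a n.+1 by apply: a0.
rewrite -(ler_pM2r an); apply: le_trans (astep n _) => //.
have {}IH : n%:R * c * a n <= a n.+1.
  apply: IH => [k kn||k kn]; [|exact: ltW|].
    by apply: a0; apply: leq_trans kn _.
  by apply: astep; apply: ltnW.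
rewrite -(ler_pM2l an1) -(lerD2r (c * a n * a n.+1)) in IH.
rewrite (_ : n.+1%:R * _ * _ * _ =
  a n.+1 * (n%:R * c * a n) + c * a n * a n.+1) //.
by rewrite -[n.+1]addn1 natrD; ring.
Qed.

(** * Common kernels of finitely many functionals *)

(** Adding a functional to the list costs at most one new spanning vector [v],
    on which the old functionals vanish and the new one does not. *)
Lemma common_kernel_finite_codim (F : fieldType) (V : lmodType F) (I : eqType)
    (f : I -> V -> F) (s : seq I) : (forall i, scalar (f i)) ->
  exists (n : nat) (e : 'I_n -> V), forall x, exists c : 'I_n -> F,
    forall i, i \in s -> f i (x - \sum_(j < n) c j *: e j) = 0.
Proof.
move=> lf; have fE i a x y : f i (x - a *: y) = f i x - a * f i y.
  by rewrite addrC -scaleNr lf mulNr addrC.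
elim: s => [|i s [n [e IH]]].
  by exists 0%N, (fun=> 0) => x; exists (fun=> 0) => j; rewrite in_nil.
have [[v [vs vi]]|nov] := pselect
  (exists v, (forall j, j \in s -> f j v = 0) /\ f i v != 0).
- exists n.+1, (fun j => oapp e v (unlift ord0 j)) => x.
  have [c cs] := IH x.
  pose t := f i (x - \sum_(j < n) c j *: e j) / f i v.
  exists (fun j => oapp c t (unlift ord0 j)) => j.
  rewrite big_ord_recl unlift_none /= addrC opprD addrAC.
  under eq_bigr do rewrite liftK /=.
  rewrite [- _ + x]addrC addrAC fE inE => /orP[/eqP ->|js].
    by rewrite /t divfK ?subrr.
  by rewrite cs // vs // mulr0 subr0.
- (* Here f i vanishes on the common kernel of s, so e serves unchanged. *)
  exists n, e => x; have [c cs] := IH x; exists c => j.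
  rewrite inE => /orP[/eqP ->|]; last exact: cs.
  by apply/eqP/negPn/negP => h; apply: nov; eexists; split; [exact: cs|].
Qed.

Lemma common_kernel_nontrivial (R : realType) (V : lmodType R[i]) (I : eqType)
    (f : I -> V -> R[i]) (s : seq I) :
  infinite_dimensional V -> (forall i, scalar (f i)) ->
  exists2 x, x != 0 & forall i, i \in s -> f i x = 0.
Proof.
move=> Vinf lf; have [n [e ne]] := common_kernel_finite_codim s lf.
apply: contrapT => triv; apply: Vinf; exists n, e => x.
have [c xc] := ne x; exists c.
apply/eqP; rewrite -subr_eq0; apply/negPn/negP => h.
by apply: triv; eexists; [exact: h|].
Qed.

(** * Inner product estimates *)

Lemma dot_conj (R : realType) (V : lmodType R[i]) (ip : {dot V for conjC})
    (x y : V) : ip y x = conjC (ip x y).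
Proof. by rewrite (hermC ip y x) expr0 mul1r. Qed.

Section InnerProduct.
Context {R : realType} {H : hilbertType R}.
Implicit Types x y : H.

Lemma orthogonal_norm_le x y : inner x y = 0 -> `|x| <= `|y - x|.
Proof.
move=> xy; have yx : inner y x = 0 by rewrite (dot_conj inner x) xy rmorph0.
rewrite -(@ler_pXn2r _ 2) ?nnegrE // -!inner_norm.
rewrite !linearB /= !linearBl /= xy yx !inner_norm.
by rewrite subr0 sub0r opprK lerDr exprn_ge0.
Qed.

(** The Cauchy-Schwarz inequality, in arbitrary dimension. *)
Lemma inner_norm_le x y : `|inner x y| <= `|x| * `|y|.
Proof.
have [->|y0] := eqVneq y 0; first by rewrite linear0 !normr0 mulr0.
have y0' : 0 < `|y| by rewrite normr_gt0.
rewrite -(@ler_pXn2r _ 2) ?nnegrE ?mulr_ge0 // normCK exprMn.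
set s := inner x y; pose b := `|y| ^+ 2.
have b0 : 0 < b by rewrite exprn_gt0.
(* Up to the factor b this vector is the component of x orthogonal to y. *)
have : 0 <= inner (b *: x - s *: y) (b *: x - s *: y).
  by rewrite inner_norm exprn_ge0.
rewrite !linearB /= !linearBl /= !linearZ /= !linearZl_LR /=.
rewrite (dot_conj inner x y) !inner_norm -/s -/b /GRing.scale /=.
have -> : conjC b = b by apply/conj_Creal/gtr0_real.
set a := _ ^+ 2; set t := conjC s => h.
have {h} : 0 <= b * (a * b - s * t).
  by move: h; congr (0 <= _); ring.
by rewrite pmulr_rge0 // subr_ge0.
Qed.

(** Take for [s] the centres of a finite [e]-net of the image of the unit ball:
    a vector of that image which is orthogonal to a centre at distance less
    than [e] has norm less than [e], by Pythagoras. *)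
Lemma compact_small_orthogonal (T : {linear H -> H}) (e : R[i]) :
  0 < e -> compact_operator T ->
  exists s : seq H, forall x, (forall y, y \in s -> inner (T x) y = 0) ->
    `|T x| <= e * `|x|.
Proof.
move=> e0; rewrite /compact_operator precompactE compact_cover.
move=> /(_ H setT (fun y => (ball y e)°)) [||s _ cov].
- by move=> y _; exact: open_interior.
- move=> y _; exists y => //; exact: nbhsx_ballx.
exists s => x orth.
have [->|x0] := eqVneq x 0; first by rewrite linear0 !normr0 mulr0.
have nx : 0 < `|x| by rewrite normr_gt0.
pose u := `|x|^-1 *: x.
have : closure (T @` [set x : H | `|x| <= 1]) (T u).
  apply: subset_closure; exists u => //=.
  by rewrite normrZ normfV normr_id mulVf ?gt_eqF.
move=> /cov[y ys] /interior_subset; rewrite -ball_normE /= => yu.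
have : `|T u| <= e.
  apply: le_trans (ltW yu); apply: orthogonal_norm_le.
  by rewrite linearZ linearZl_LR /= orth ?mulr0.
by rewrite linearZ /= normrZ normfV normr_id mulrC ler_pdivrMr.
Qed.

End InnerProduct.

(** * The upper left corner of a normal block operator *)

Lemma normal_inner_adjoint (R : realType) (V : lmodType R[i])
    (ip : {dot V for conjC}) (T S : V -> V) (x : V) :
  is_adjoint ip T S -> T \o S =1 S \o T -> ip (T x) (T x) = ip (S x) (S x).
Proof.
move=> adj com; rewrite adj.
have /= <- := com x.
by rewrite (dot_conj ip _ x) adj -dot_conj.
Qed.

Lemma bounded_operator_gt0 {R : realType} {V W : normedModType R[i]}
    (T : V -> W) :
  bounded_operator T -> exists2 M : R, 0 < M & forall x, `|T x| <= M%:C * `|x|.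
Proof.
move=> [M TM]; exists (`|M| + 1); first by rewrite ltr_wpDl.
move=> x; apply: le_trans (TM x) _; rewrite ler_wpM2r // lecR.
by apply: le_trans (ler_norm _) _; rewrite lerDl.
Qed.

(** This is the upper left block of [D^* D = D D^*] as an identity of quadratic
    forms: [p] and [q] are [D1^* x] and [D2^* x], the components of
    [D^* (x, 0)].  Stated in this way it does not call for adjoints of the
    blocks themselves. *)
Lemma normal_block_norm (R : realType) (H : hilbertType R)
    (D : {linear (H * H)%type -> (H * H)%type})
    (D1 D2 D3 D4 : {linear H -> H}) :
  D =1 block_operator D1 D2 D3 D4 -> normal_operator dsum_inner D ->
  forall x, exists p q : H,
    [/\ `|D1 x| ^+ 2 + `|D3 x| ^+ 2 = `|p| ^+ 2 + `|q| ^+ 2,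
        forall y, inner p y = inner x (D1 y) &
        forall y, inner q y = inner x (D2 y)].
Proof.
move=> DE [S [_ adj com]] x.
exists (S (x, 0)).1, (S (x, 0)).2; split.
- have : dsum_inner (D (x, 0)) (D (x, 0)) = dsum_inner (S (x, 0)) (S (x, 0)).
    exact: normal_inner_adjoint adj com.
  by rewrite DE /block_operator /dsum_inner /= !linear0 !addr0 !inner_norm.
- move=> y; rewrite (dot_conj inner y) (dot_conj inner (D1 y)); congr (conjC _).
  have : dsum_inner (D (y, 0)) (x, 0) = dsum_inner (y, 0) (S (x, 0)).
    exact: adj.
  by rewrite DE /block_operator /dsum_inner /= !linear0 linear0l !addr0.
- move=> y; rewrite (dot_conj inner y) (dot_conj inner (D2 y)); congr (conjC _).
  have : dsum_inner (D (0, y)) (x, 0) = dsum_inner (0, y) (S (x, 0)).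
    exact: adj.
  by rewrite DE /block_operator /dsum_inner /= !linear0 linear0l !add0r addr0.
Qed.

(** The vector [y] stands for a test vector: bounding [|D1^* x|] below by
    [|<D1^* x, y>| / |y|] turns the quadratic form inequality
    [|D1 x| ^ 2 >= |D1^* x| ^ 2 + (N ^- 2 - e ^ 2) |x| ^ 2] into one that
    mentions [D1] alone.  The term [N ^- 2] comes from [D2^*], which is bounded
    below by the inverse of a bound [N] for the inverse of [D2]. *)
Lemma corner_estimate {R : realType} {H : hilbertType R}
    (D1 D2 D3 : {linear H -> H}) (E : H -> H) (N e : R[i]) (x p q : H) :
  `|D1 x| ^+ 2 + `|D3 x| ^+ 2 = `|p| ^+ 2 + `|q| ^+ 2 ->
  (forall y, inner p y = inner x (D1 y)) ->
  (forall y, inner q y = inner x (D2 y)) ->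
  0 < N -> cancel E D2 -> (forall y, `|E y| <= N * `|y|) ->
  0 <= e -> `|D3 x| <= e * `|x| ->
  forall y, `|inner x (D1 y)| ^+ 2 + (N ^- 2 - e ^+ 2) * `|x| ^+ 2 * `|y| ^+ 2
    <= `|D1 x| ^+ 2 * `|y| ^+ 2.
Proof.
move=> pq pE qE N0 EK EN e0 D3x y.
have py : `|inner x (D1 y)| ^+ 2 <= `|p| ^+ 2 * `|y| ^+ 2.
  by rewrite -pE -exprMn ler_pXn2r ?nnegrE ?mulr_ge0 // inner_norm_le.
have qx : N ^- 2 * `|x| ^+ 2 <= `|q| ^+ 2.
  rewrite -exprVn -exprMn ler_pXn2r ?nnegrE ?mulr_ge0 ?invr_ge0 ?(ltW N0) //.
  rewrite mulrC ler_pdivrMr //.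
  have [->|x0] := eqVneq x 0; first by rewrite normr0 mulr_ge0 // ltW.
  have nx : 0 < `|x| by rewrite normr_gt0.
  rewrite -(ler_pM2r nx) -expr2 -inner_norm -{2}(EK x) -qE.
  have r : inner q (E x) \is Num.real.
    by rewrite qE EK inner_norm ger0_real // exprn_ge0.
  apply: le_trans (real_ler_norm r) _; apply: le_trans (inner_norm_le _ _) _.
  by rewrite -mulrA ler_wpM2l.
have D3x2 : `|D3 x| ^+ 2 <= e ^+ 2 * `|x| ^+ 2.
  by rewrite -exprMn ler_pXn2r ?nnegrE ?mulr_ge0.
have -> : `|D1 x| ^+ 2 = `|p| ^+ 2 + `|q| ^+ 2 - `|D3 x| ^+ 2.
  by rewrite -pq addrK.
rewrite -addrA [leRHS]mulrDl lerD // ler_wpM2r ?exprn_ge0 //.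
by rewrite mulrBl lerB.
Qed.

(** The estimate is used with two test vectors at each point of the orbit: the
    point itself, which shows that the next one is nonzero, and its
    predecessor, which makes the inner product a squared norm. *)
Lemma orbit_ratio_growth {R : realType} {H : hilbertType R}
    (T : H -> H) (c : R[i]) (x : H) (n : nat) :
  0 < c -> x != 0 ->
  (forall k, (k <= n)%N -> forall y,
    `|inner (iter k T x) (T y)| ^+ 2 + c * `|iter k T x| ^+ 2 * `|y| ^+ 2
    <= `|iter k.+1 T x| ^+ 2 * `|y| ^+ 2) ->
  0 < `|iter n T x| /\
  n%:R * c * `|iter n T x| ^+ 2 <= `|iter n.+1 T x| ^+ 2.
Proof.
move=> c0 x0 est.
have pos k : (k <= n.+1)%N -> 0 < `|iter k T x| ^+ 2.
  elim: k => [|k IH] kn; first by rewrite exprn_gt0 // normr_gt0.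
  have {}IH := IH (ltnW kn).
  rewrite -(pmulr_lgt0 _ IH); apply: lt_le_trans (est k kn _).
  by apply: ltr_wpDl; rewrite ?exprn_ge0 ?(mulr_gt0 (mulr_gt0 c0 IH) IH).
split.
  rewrite normr_gt0; apply/eqP => xn; have := pos n (leqnSn n).
  by rewrite xn normr0 expr0n ltxx.
apply: (ratio_growth (a := fun k => `|iter k T x| ^+ 2)) => [|||k kn].
- exact: ltW.
- by move=> k kn; apply: pos; apply: leqW.
- by apply: exprn_ge0.
- have := est k.+1 kn (iter k T x).
  by rewrite -iterS inner_norm ger0_norm ?exprn_ge0 // mulrAC.
Qed.

(** * The theorem *)

Unset Implicit Arguments.
Set Printing Implicit Defensive.

Theorem proposition3p3 (R : realType) (H : hilbertType R)
    (Hinf : infinite_dimensional H) (Hsep : separable H) :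
  ~ exists (D : {linear (H * H)%type -> (H * H)%type})
           (D1 D2 D3 D4 : {linear H -> H}),
      bounded_operator D /\
      [/\ bounded_operator D1, bounded_operator D2,
          bounded_operator D3 & bounded_operator D4] /\
      D =1 block_operator D1 D2 D3 D4 /\
      normal_operator dsum_inner D /\
      invertible_operator D2 /\
      compact_operator D3.
Proof.
move=> [D [D1 [D2 [D3 [D4]]]]].
move=> [_ [[/bounded_operator_gt0[M M0 D1M] _ _ _]]].
move=> [DE [Dnorm [[E [/bounded_operator_gt0[N N0 EN] _ EK]] D3c]]].
(* Any e below the inverse of N would do: it keeps c positive. *)
pose e : R[i] := (2 * N%:C)^-1; pose c : R[i] := N%:C ^- 2 - e ^+ 2.
have N0' : 0 < N%:C by rewrite ltcR.
have M0' : 0 < M%:C by rewrite ltcR.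
have e0 : 0 < e by rewrite invr_gt0 mulr_gt0.
have cE : c = (3 / (4 * N ^+ 2))%:C.
  rewrite /c /e !(rmorphM, fmorphV, rmorphXn, rmorph_nat) /=; field.
  by rewrite gt_eqF.
have r0 : 0 < 3 / (4 * N ^+ 2) by rewrite divr_gt0 // mulr_gt0 // exprn_gt0.
have c0 : 0 < c by rewrite cE ltcR.
have [net netP] := compact_small_orthogonal e0 D3c.
have [n nM] : exists n : nat, M ^+ 2 < n%:R * (3 / (4 * N ^+ 2)).
  exists (Num.bound (M ^+ 2 / (3 / (4 * N ^+ 2)))).
  by rewrite -ltr_pdivrMr // archi_boundP // divr_ge0 ?exprn_ge0 // ltW.
(* The value at (k, y) is the equation that the net point y imposes on the k-th
   point of the orbit. *)
pose f (i : nat * H) x := inner (D3 (iter i.1 D1 x)) i.2.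
have lf i : scalar (f i).
  have lin k : linear (iter k D1).
    by elim: k => [|k IH] a u v //=; rewrite IH linearP.
  by move=> a u v; rewrite /f lin linearP linearPl.
have [x x0 xP] := common_kernel_nontrivial
  [seq (k, y) | k <- iota 0 n.+1, y <- net] Hinf lf.
have [] := orbit_ratio_growth (T := D1) (n := n) c0 x0.
  move=> k kn.
  have [p [q [pq pE qE]]] := normal_block_norm DE Dnorm (iter k D1 x).
  apply: corner_estimate pq pE qE N0' EK EN (ltW e0) _.
  apply: netP => y ynet; apply: (xP (k, y)).
  by apply/allpairsP; exists (k, y); split; rewrite ?mem_iota.
move=> xn0; apply/negP; rewrite lt_geF //.
have : `|iter n.+1 D1 x| ^+ 2 <= (M ^+ 2)%:C * `|iter n D1 x| ^+ 2.
  by rewrite rmorphXn -exprMn ler_pXn2r ?nnegrE ?mulr_ge0 // ?(ltW M0') /=.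
move=> /le_lt_trans; apply.
rewrite ltr_pM2r ?exprn_gt0 // cE.
by rewrite -(rmorph_nat (real_complex R)) -rmorphM ltcR.
Qed.
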